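(* Let $R$ be a Noetherian commutative ring and let $I\subset R$ be an ideal of height $h$. Then for every integer $j$ with $1\le j\le h-1$ we have $$\sqrt{\mathrm{Fitt}_j(I)}=\sqrt{\mathrm{Fitt}_j(\sqrt{I})}.$$
   Context: For a finitely generated module $M$ over a Noetherian ring $R$, choose a finite free presentation $G\to F\to M\to 0$ with $\mathrm{rank}\,F=r$, and let $A$ be a matrix representing $G\to F$. The $j$th Fitting ideal of $M$ is $\mathrm{Fitt}_j(M)=I_{r-j}(A)$, where $I_t(A)$ is the ideal generated by the $t$-minors of $A$, with $I_t(A)=R$ for $t\le 0$. This is independent of the choices. An ideal $I$ is regarded as an $R$-module. *)

(* Defs.v *)
From HB Require Import structures.
From mathcomp Require Import all_boot all_order all_algebra.
From mathcomp Require Import boolp classical_sets constructive_ereal.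

Set Implicit Arguments.
Unset Strict Implicit.
Unset Printing Implicit Defensive.

Import Order.TTheory GRing.Theory Num.Theory.

Local Open Scope classical_set_scope.
Local Open Scope ring_scope.

(** An ideal of [R] is a submodule of the regular module [R^o]. *)
Definition is_ideal (R : comPzRingType) (I : set R) : Prop :=
  GRing.submod_closed (mem I : {pred R^o}).

Record ideal (R : comPzRingType) : Type := Ideal {
  ideal_set :> set R;
  ideal_setP : is_ideal ideal_set
}.

Section IdealAsModule.
Variables (R : comPzRingType) (I : ideal R).

Definition ideal_pred : {pred R^o} := mem (ideal_set I).

HB.instance Definition _ :=
  GRing.isSubmodClosed.Build R R^o ideal_pred
    (GRing.submod_closed_semi (ideal_setP I)).

Definition ideal_mod : Type := {x : R^o | x \in ideal_pred}.

HB.instance Definition _ := SubChoice.on ideal_mod.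
HB.instance Definition _ := [SubChoice_isSubLmodule of ideal_mod by <:].
End IdealAsModule.

Section IdealConstructions.
Variable R : comPzRingType.

Lemma ideal_gen_subproof (S : set R) : is_ideal (smallest (@is_ideal R) S).
Proof.
split=> [|a x y /set_mem Sx /set_mem Sy]; apply: mem_set.
  by move=> J [[J0 _] _]; exact: set_mem J0.
move=> J JS; have [[_ JD] _] := JS; apply: set_mem.
by apply: JD; apply: mem_set; [exact: Sx | exact: Sy].
Qed.

Definition ideal_gen (S : set R) : ideal R := Ideal (ideal_gen_subproof S).

Definition noetherian : Prop :=
  forall I : ideal R, exists s : seq R, (I : set R) = ideal_gen [set` s].

Lemma radical_subproof (I : ideal R) :
  is_ideal [set x : R | exists n : nat, (x ^+ n) \in (I : set R)].
Proof.
have [I0 IL] := ideal_setP I.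
have IM (a x : R) : x \in (I : set R) -> a * x \in (I : set R).
  by move=> Ix; have := IL a _ _ Ix I0; rewrite addr0.
have ID (x y : R) : x \in (I : set R) -> y \in (I : set R) ->
    x + y \in (I : set R).
  by move=> Ix Iy; have := IL 1 _ _ Ix Iy; rewrite scale1r.
split=> [|a x y /set_mem[m Ixm] /set_mem[n Iyn]]; apply: mem_set => /=.
  by exists 1%N.
exists (m + n)%N; rewrite exprDn.
elim/big_ind: _ => [|u v Iu Iv|i _]; [exact: I0 | exact: ID |].
rewrite -mulr_natl; apply: (IM _ _).
have [leni|ltin] := leqP n i.
  by rewrite -(subnK leni) exprD mulrA; apply: (IM _ _).
have -> : (m + n - i = (n - i) + m)%N by rewrite -addnBA 1?ltnW // addnC.
rewrite mulrC [a *: x]/(a * x) exprD; apply: (IM _ _); apply: (IM _ _).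
by rewrite exprMn; apply: (IM _ _).
Qed.

Definition radical (I : ideal R) : ideal R := Ideal (radical_subproof I).

Definition is_prime (P : set R) : Prop :=
  [/\ is_ideal P, ~ P 1 & forall x y, P (x * y) -> P x \/ P y].

Definition prime_chain (P : set R) (n : nat) : Prop :=
  exists c : nat -> set R,
    [/\ forall i, (i <= n)%N -> is_prime (c i),
        forall i, (i < n)%N -> c i `<` c i.+1
      & c n = P].

(** Heights are natural numbers or [+oo], taken in [\bar int]; the height of
    the unit ideal, an infimum over no prime at all, is [+oo]. *)
Definition prime_height (P : set R) : \bar int :=
  supremum 0%E [set (n%:Z)%:E | n in prime_chain P].

Definition height (I : ideal R) : \bar int :=
  infimum +oo%E
    [set prime_height P | P in [set P | is_prime P /\ (I : set R) `<=` P]].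

Definition minors (m n : nat) (A : 'M[R]_(m, n)) (t : nat) : set R :=
  [set x | exists (f : 'I_t -> 'I_m) (g : 'I_t -> 'I_n),
     [/\ {homo f : i j / (i < j)%N}, {homo g : i j / (i < j)%N}
       & x = \det (mxsub f g A)]].

Definition minors_ideal (m n : nat) (A : 'M[R]_(m, n)) (t : nat) : ideal R :=
  ideal_gen (minors A t).

(** A finite free presentation [R^s -> R^r -> M -> 0], with elements of [R^s]
    and [R^r] seen as row vectors: the first map is [w |-> w *m A]. *)
Record presentation (M : lmodType R) : Type := Presentation {
  pres_rank : nat;
  pres_nrels : nat;
  pres_mx : 'M[R]_(pres_nrels, pres_rank);
  pres_map : {linear 'rV[R]_pres_rank -> M};
  pres_surj : forall x : M, exists v, pres_map v = x;
  pres_exact : forall v, pres_map v = 0 <-> exists w, v = w *m pres_mx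
}.

(** The truncated subtraction is harmless: the only [0]-minor is the empty
    determinant [1], so the ideal of [0]-minors is the unit ideal.  A module
    without finite free presentation (never the case of a finitely generated
    module over a noetherian ring) gets the dummy value [0]. *)
Definition Fitt (j : nat) (M : lmodType R) : ideal R :=
  if pselect (exists _ : presentation M, True) is left ex then
    let p := projT1 (cid ex) in
    minors_ideal (pres_mx p) (pres_rank p - j)
  else ideal_gen set0.

End IdealConstructions.

Arguments noetherian R : clear implicits.

(* Main.v *)
From HB Require Import structures.
Require Import Defs.
From mathcomp Require Import all_boot all_order all_algebra perm.
From mathcomp Require Import boolp classical_sets constructive_ereal.
From mathcomp Require Import ring.

(** For 1 <= j < ht I both sides are the radical of I itself: the lemma
    [radical_Fitt] says that the radical of Fitt_j(I) is that of I, and it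
    applies to the radical of I as well, which has the same height because the
    same primes contain it.

    That I is contained in the radical of Fitt_j(I) uses 1 <= j.  Let
    a_1, ..., a_r be generators of I.  The Koszul relations
    a_i e_k - a_k e_i, for r - j indices k other than i, have a minor equal to
    a_i ^ (r - j) ([koszul_minor]).

    Conversely, let D be an (r - j)-minor of the matrix of relations.  By
    Cramer's rule D I is contained in the ideal J generated by the at most j
    generators whose columns are not used by D ([minor_mul_generator]).  If D
    were not in the radical of I, some prime P minimal over I would avoid D
    ([minimal_over_avoid]); then P is also minimal over J, so Krull's height
    theorem ([krull_height]) gives ht P <= j, hence ht I <= j.

    Krull's theorem is proved without constructing localizations.  Working in
    the local ring at P amounts to reading membership in J as membership in
    [sat P J], the set of all x such that s x is in J for some s outside P,
    which is the contraction to R of the extension of J. *)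

Set Implicit Arguments.
Unset Strict Implicit.
Unset Printing Implicit Defensive.

Import Order.TTheory GRing.Theory Num.Theory.

Local Open Scope classical_set_scope.
Local Open Scope ring_scope.

(** * Ideals, localized membership and minimal primes *)

Section Ideals.
Variable R : comPzRingType.
Implicit Types (I J K P Q T : set R) (a b x y z : R) (l : seq R).

Lemma is_idealP J :
  is_ideal J <-> J 0 /\ forall a x y, J x -> J y -> J (a * x + y).
Proof.
split=> [[J0 JL]|[J0 JL]]; split.
- exact: set_mem J0.
- by move=> a x y Jx Jy; apply: set_mem; apply: JL; apply: mem_set.
- exact: mem_set.
- by move=> a x y /set_mem Jx /set_mem Jy; apply: mem_set; apply: JL.
Qed.

Lemma ideal0 J : is_ideal J -> J 0.
Proof. by case/is_idealP. Qed.

Lemma idealL J a x y : is_ideal J -> J x -> J y -> J (a * x + y).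
Proof. by case/is_idealP=> _; apply. Qed.

Lemma idealM J a x : is_ideal J -> J x -> J (a * x).
Proof. by move=> iJ Jx; rewrite -[a * x]addr0; apply: idealL (ideal0 iJ). Qed.

Lemma idealD J x y : is_ideal J -> J x -> J y -> J (x + y).
Proof. by move=> iJ Jx Jy; rewrite -[x]mul1r; apply: idealL. Qed.

Lemma idealB J x y : is_ideal J -> J x -> J y -> J (x - y).
Proof.
by move=> iJ Jx Jy; rewrite addrC -mulN1r; apply: idealL.
Qed.

Lemma ideal_sum J n (F : 'I_n -> R) :
  is_ideal J -> (forall i, J (F i)) -> J (\sum_i F i).
Proof.
move=> iJ JF; elim/big_ind: _ => [|x y|i _]; first exact: ideal0.
  exact: idealD.
exact: JF.
Qed.

Lemma prime_ideal P : is_prime P -> is_ideal P.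
Proof. by case. Qed.

Lemma primeM P x y : is_prime P -> P (x * y) -> ~ P x -> P y.
Proof. by case=> _ _ pP /pP[]. Qed.

Lemma primeMn P x y : is_prime P -> ~ P x -> ~ P y -> ~ P (x * y).
Proof. by move=> pP nx ny /(primeM pP) /(_ nx). Qed.

Lemma primeX P x n : is_prime P -> P (x ^+ n) -> P x.
Proof.
move=> pP; elim: n => [|n IH]; first by rewrite expr0; case: pP.
by rewrite exprS; case: (pP) => _ _ /[apply] -[].
Qed.

Definition adjoin J x : set R := [set z | exists r w, J w /\ z = r * x + w].

Lemma adjoin_ideal J x : is_ideal J -> is_ideal (adjoin J x).
Proof.
move=> iJ; apply/is_idealP; split.
  by exists 0, 0; split; [exact: ideal0 | ring].
move=> a _ _ [r1 [w1 [J1 ->]]] [r2 [w2 [J2 ->]]].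
by exists (a * r1 + r2), (a * w1 + w2); split; [exact: idealL | ring].
Qed.

Lemma adjoin_sub J x : J `<=` adjoin J x.
Proof. by move=> w Jw; exists 0, w; split=> //; ring. Qed.

Lemma adjoin_mem J x : is_ideal J -> adjoin J x x.
Proof. by move=> iJ; exists 1, 0; split; [exact: ideal0 | ring]. Qed.

Lemma adjoin_min J x T : is_ideal T -> J `<=` T -> T x -> adjoin J x `<=` T.
Proof.
by move=> iT JT Tx _ [r [w [Jw ->]]]; apply: idealL => //; apply: JT.
Qed.

Lemma adjoinS J K x : J `<=` K -> adjoin J x `<=` adjoin K x.
Proof. by move=> JK _ [r [w [Jw ->]]]; exists r, w; split=> //; apply: JK. Qed.

Definition ideal_span l : set R := foldr (fun x J => adjoin J x) [set 0] l.

Lemma ideal_span_ideal l : is_ideal (ideal_span l).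
Proof.
elim: l => [|x l IH] /=; last exact: adjoin_ideal.
by apply/is_idealP; split=> // a x y /= -> ->; ring.
Qed.

Lemma ideal_span_mem l x : x \in l -> ideal_span l x.
Proof.
elim: l => // y l IH; rewrite inE => /orP[/eqP->|/IH]; last exact: adjoin_sub.
exact/adjoin_mem/ideal_span_ideal.
Qed.

Lemma ideal_span_min l T :
  is_ideal T -> (forall x, x \in l -> T x) -> ideal_span l `<=` T.
Proof.
move=> iT; elim: l => [_ _ -> /=|y l IH lT]; first exact: ideal0.
apply: adjoin_min => //; last by apply: lT; rewrite mem_head.
by apply: IH => x lx; apply: lT; rewrite inE lx orbT.
Qed.

Lemma ideal_gen_min (G : set R) T :
  is_ideal T -> G `<=` T -> (ideal_gen G : set R) `<=` T.
Proof. by move=> iT GT z; apply; split. Qed.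

Lemma ideal_gen_sub (G : set R) : G `<=` (ideal_gen G : set R).
Proof. by move=> z Gz J [_]; apply. Qed.

Lemma ideal_gen_span l : (ideal_gen [set` l] : set R) = ideal_span l.
Proof.
apply/seteqP; split.
  apply: ideal_gen_min => [|x /= lx]; first exact: ideal_span_ideal.
  exact: ideal_span_mem.
apply: ideal_span_min; first exact: ideal_setP.
by move=> x lx; apply: ideal_gen_sub.
Qed.

Definition colon J b : set R := [set r | J (r * b)].

Lemma colon_ideal J b : is_ideal J -> is_ideal (colon J b).
Proof.
move=> iJ; apply/is_idealP; split; rewrite /colon /=.
  by rewrite mul0r; exact: ideal0.
by move=> a x y Jx Jy; rewrite mulrDl -mulrA; exact: idealL.
Qed.

Lemma colon_sub J b : is_ideal J -> J `<=` colon J b.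
Proof. by move=> iJ x Jx; rewrite /colon /= mulrC; exact: idealM. Qed.

Definition sat P J : set R := [set x | exists s, ~ P s /\ J (s * x)].

Lemma sat_ideal P J : is_prime P -> is_ideal J -> is_ideal (sat P J).
Proof.
move=> pP iJ; apply/is_idealP; split.
  by exists 1; split; [case: pP | rewrite mulr0; exact: ideal0].
move=> a x y [s [ns Jx]] [t [nt Jy]].
exists (s * t); split; first exact: primeMn.
have ->: s * t * (a * x + y) = (t * a) * (s * x) + s * (t * y) by ring.
by apply: idealL => //; exact: idealM.
Qed.

Lemma sat_sub P J : is_prime P -> J `<=` sat P J.
Proof. by move=> pP x Jx; exists 1; rewrite mul1r; split=> //; case: pP. Qed.

Definition minimal_over P J :=
  [/\ is_prime P, J `<=` P &
      forall T, is_prime T -> J `<=` T -> T `<=` P -> P `<=` T].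

(** Nakayama's lemma at P: if the extension L to the local ring of the ideal
    spanned by l satisfies L <= E + x L with x in P, then L <= E.  Induction on
    l: as s - x r is a unit at P whenever s is, the hypothesis on the head a
    expresses a through the tail, which removes a from the other hypotheses. *)
Lemma nakayama P E x l : is_prime P -> is_ideal E -> P x ->
  (forall b, b \in l ->
     exists s e w, [/\ ~ P s, E e, ideal_span l w & s * b = e + x * w]) ->
  ideal_span l `<=` sat P E.
Proof.
move=> pP iE Px; have iP := prime_ideal pP; have iS := sat_ideal pP iE.
elim: l => [_ _ ->|a l IH H]; first exact: ideal0.
have [|s [e [_ [ns Ee [r [w [lw ->]]] Esa]]]] := H a; first exact: mem_head.
pose s1 := s - x * r.
have ns1 : ~ P s1.
  move=> Ps1; apply: ns; rewrite -[s](subrK (x * r)).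
  by apply: idealD => //; rewrite mulrC; exact: idealM.
have Es1 : s1 * a = e + x * w by rewrite mulrBl Esa; ring.
have lE : ideal_span l `<=` sat P E.
  apply: IH => b lb; have [|t [e' [_ [nt Ee' [r' [w' [lw' ->]]] Etb]]]] := H b.
    by rewrite inE lb orbT.
  exists (s1 * t), (x * r' * e + s1 * e'), (r' * x * w + s1 * w'); split.
  - exact: primeMn.
  - by apply: idealL => //; exact: idealM.
  - have iL := ideal_span_ideal l.
    by apply: idealL => //; exact: idealM.
  - rewrite -mulrA Etb.
    have ->: s1 * (e' + x * (r' * a + w')) =
             s1 * e' + x * r' * (s1 * a) + x * s1 * w' by ring.
    by rewrite Es1; ring.
apply: adjoin_min => //.
have [t [nt Etw]] := lE _ lw.
exists (t * s1); split; first exact: primeMn.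
rewrite -mulrA Es1; have ->: t * (e + x * w) = t * e + x * (t * w) by ring.
by apply: idealL => //; exact: idealM.
Qed.

End Ideals.

(** * Noetherian rings *)

Section Noetherian.
Variable R : comPzRingType.
Hypothesis noethR : noetherian R.
Implicit Types (I J K P Q T : set R) (a b x y z : R) (l : seq R).

Lemma noetherian_fg J : is_ideal J -> exists l, J = ideal_span l.
Proof.
move=> iJ; have [l El] := noethR (Ideal iJ).
by exists l; rewrite -ideal_gen_span -El.
Qed.

(** Without a maximal element, F would contain a strictly increasing sequence;
    finitely many generators of its union already lie in one of its terms. *)
Lemma noetherian_max (F : set R -> Prop) :
  (forall J, F J -> is_ideal J) -> (exists J, F J) ->
  exists J, F J /\ forall K, F K -> J `<=` K -> K `<=` J.
Proof.
move=> idF [J0 FJ0]; apply: contrapT => nomax.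
have next (J : {J | F J}) : exists K : {J | F J}, sval J `<` sval K.
  case: J => J FJ /=; apply: contrapT => nK; apply: nomax; exists J; split=> //.
  move=> K FK JK; apply: contrapT => nKJ; apply: nK.
  by exists (exist _ K FK).
have [f fP] := choice next.
pose c n := sval (iter n f (exist _ J0 FJ0)).
have cS n : c n `<` c n.+1 by exact: fP.
have ci n : is_ideal (c n) by apply: idF; exact: svalP.
have cle m n : (m <= n)%N -> c m `<=` c n.
  move=> /subnK <-; elim: (n - m)%N => // k IH.
  by apply: (subset_trans IH); case: (cS (k + m)%N).
pose U : set R := [set x | exists n, c n x].
have iU : is_ideal U.
  apply/is_idealP; split; first by exists 0%N; exact: ideal0.
  move=> a x y [m cx] [n cy]; exists (maxn m n); apply: idealL => //.
    exact: (cle m _ (leq_maxl m n)).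
  exact: (cle n _ (leq_maxr m n)).
have [l El] := noetherian_fg iU.
have lU x : x \in l -> U x by move=> lx; rewrite El; exact: ideal_span_mem.
have [N lN] : exists N, forall x, x \in l -> c N x.
  elim: l lU {El} => [|x l IH] lU; first by exists 0%N.
  have [|N HN] := IH; first by move=> y ly; apply: lU; rewrite inE ly orbT.
  have [|n cx] := lU x; first exact: mem_head.
  exists (maxn n N) => y; rewrite inE => /orP[/eqP->|/HN].
    exact: (cle n _ (leq_maxl n N)).
  exact: (cle N _ (leq_maxr n N)).
have [_] := cS N; apply=> x cx.
by have /(ideal_span_min (ci N) lN) : ideal_span l x by rewrite -El; exists N.+1.
Qed.

(** A maximal element b among the proper ideals (K : b) works: if x y b is in K
    and y b is not, then (K : y b) contains (K : b), hence equals it, and x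
    belongs to it. *)
Lemma prime_colon_exists K : is_ideal K -> ~ K 1 ->
  exists b, ~ K b /\ is_prime (colon K b).
Proof.
move=> iK K1.
pose F J := exists b, ~ K b /\ J = colon K b.
have [||J [[b [nb ->]] mx]] := @noetherian_max F.
- by move=> _ [b [_ ->]]; exact: colon_ideal.
- by exists (colon K 1), 1.
exists b; split=> //; split; first exact: colon_ideal.
  by rewrite /colon /= mul1r.
move=> x y; rewrite /colon /= => Kxy.
have [Ky|nKy] := pselect (K (y * b)); [by right | left].
apply: (mx (colon K (y * b))).
- by exists (y * b).
- move=> z; rewrite /colon /= => Kz.
  by have ->: z * (y * b) = y * (z * b) by [ring]; exact: idealM.
- by rewrite /colon /= mulrA.
Qed.

(** Writing r for the radical of I, a prime of the form P = (r : c) is minimal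
    over I: a prime T between I and P contains r, and c is not in T since
    otherwise c ^ 2 would be in r, so c P <= r <= T forces P <= T.  Taking c to
    be a multiple of x makes P avoid x for the same reason. *)
Lemma minimal_over_avoid I x : is_ideal I -> (forall n, ~ I (x ^+ n)) ->
  exists P, minimal_over P I /\ ~ P x.
Proof.
move=> iI nx.
pose r := radical (Ideal iI).
have rP y : (r : set R) y <-> exists n, I (y ^+ n).
  by split=> -[n In]; exists n; [exact: set_mem In | exact: mem_set].
have ir : is_ideal r := ideal_setP r.
have rsq y : (r : set R) (y * y) -> (r : set R) y.
  by move=> /rP[n In]; apply/rP; exists (n + n)%N; rewrite exprD -exprMn.
have [||b [nb pP]] := @prime_colon_exists (colon r x).
- exact: colon_ideal.
- by rewrite /colon /= mul1r => /rP[n]; exact: nx.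
pose c := b * x.
have Pc z : colon (colon r x) b z = (r : set R) (z * c).
  by rewrite /colon /= mulrA.
have nPc : ~ colon (colon r x) b c by rewrite Pc => /rsq.
exists (colon (colon r x) b); split; last first.
  by move=> Px; apply: nPc; exact: (idealM b (prime_ideal pP) Px).
split=> //.
  move=> z Iz; rewrite Pc mulrC; apply: idealM => //; apply/rP.
  by exists 1%N.
move=> T pT IT TP z; rewrite Pc => /rP[n /IT /(primeX pT)].
by rewrite mulrC => /(primeM pT); apply=> /TP.
Qed.

(** P is the only prime of the local ring at P that contains J, so its elements
    are nilpotent modulo J: otherwise K, the set of z killed modulo J by a power
    of y up to a unit at P, would be proper and some prime (K : b) would contain
    J, be contained in P and avoid y. *)
Lemma minimal_over_nilp P J y : is_ideal J -> minimal_over P J -> P y ->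
  exists n, sat P J (y ^+ n).
Proof.
move=> iJ [pP JP mP] Py; apply: contrapT => nsat.
have iS := sat_ideal pP iJ.
pose K : set R := [set z | exists n, sat P J (y ^+ n * z)].
have iK : is_ideal K.
  apply/is_idealP; split; first by exists 0%N; rewrite mulr0; exact: ideal0.
  move=> a u v [m Su] [n Sv]; exists (m + n)%N.
  have ->: y ^+ (m + n) * (a * u + v) =
    (y ^+ n * a) * (y ^+ m * u) + y ^+ m * (y ^+ n * v) by rewrite exprD; ring.
  by apply: idealL => //; exact: idealM.
have [|b [nb pT]] := prime_colon_exists iK.
  by case=> n; rewrite mulr1 => Sn; apply: nsat; exists n.
have /(_ y Py) : P `<=` colon K b.
  apply: mP => //.
    move=> z Jz; rewrite /colon /=; exists 0%N; rewrite mul1r mulrC.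
    by apply: idealM => //; exact: sat_sub.
  move=> z; rewrite /colon /= => -[n [s [ns Js]]].
  apply: contrapT => nz; apply: nb; exists n, (s * z); split.
    exact: primeMn.
  by have <-: s * (y ^+ n * (z * b)) = s * z * (y ^+ n * b) by ring.
rewrite /colon /= => -[n Sn]; apply: nb; exists n.+1.
by rewrite exprSr -mulrA.
Qed.

(** When P is minimal over J, the local ring at P modulo J is artinian.
    Noetherian induction: let K be maximal among the ideals above J whose
    descending chains do not all stabilize.  Some a, not in K at P, satisfies
    P a <= K at P, so K + (a) is a simple extension of K at P, and a chain above
    K stabilizes because C n + (a) does and C n meets K + (a) eventually
    constantly, in either K or K + (a). *)
Lemma local_dcc P J : is_ideal J -> minimal_over P J ->
  forall C : nat -> set R, (forall n, is_ideal (C n)) ->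
  (forall n, J `<=` C n) -> (forall n, C n.+1 `<=` C n) ->
  exists N, forall n, (N <= n)%N -> C n `<=` sat P (C n.+1).
Proof.
move=> iJ [pP JP mP].
pose stable K := forall C : nat -> set R, (forall n, is_ideal (C n)) ->
  (forall n, K `<=` C n) -> (forall n, C n.+1 `<=` C n) ->
  exists N, forall n, (N <= n)%N -> C n `<=` sat P (C n.+1).
apply: contrapT => nst.
have [||K [[iK JK nK] mx]] :=
  @noetherian_max (fun K => [/\ is_ideal K, J `<=` K & ~ stable K]).
- by move=> ? [].
- by exists J; split.
apply: nK => C iC KC dC.
have cle m n : (m <= n)%N -> C n `<=` C m.
  move=> /subnK <-; elim: (n - m)%N => // k IH.
  by apply: (subset_trans (dC _)).
(* If K is not contained in P, everything is in K at P. *)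
have [KP|] := pselect (K `<=` P); last first.
  move=> /existsNP[s /not_implyP[Ks ns]].
  exists 0%N => n _ c _; exists s; split=> //.
  by rewrite mulrC; apply: idealM => //; exact: KC.
have iS := sat_ideal pP iK.
have [|a [na pT]] := prime_colon_exists iS.
  by case=> s [ns]; rewrite mulr1 => /KP.
have PT : P `<=` colon (sat P K) a.
  apply: mP => //.
    by move=> z /JK Kz; apply: colon_sub => //; exact: sat_sub.
  move=> z [s [ns Ks]]; apply: contrapT => nz; apply: na.
  by exists (s * z); rewrite -mulrA; split=> //; exact: primeMn.
have stK' : stable (adjoin K a).
  apply: contrapT => nst'; apply: na; apply: sat_sub => //.
  apply: (mx (adjoin K a)); last exact: adjoin_mem.
    split=> //; first exact: adjoin_ideal.
    by apply: (subset_trans JK); exact: adjoin_sub.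
  exact: adjoin_sub.
have [||| N1 HN1] := stK' (fun n => adjoin (C n) a).
- by move=> n; exact: adjoin_ideal.
- by move=> n; exact: adjoinS.
- by move=> n; exact: adjoinS.
have step n c : (N1 <= n)%N -> C n c ->
    exists s d r, [/\ ~ P s, C n.+1 d, C n (r * a) & s * c = r * a + d].
  move=> len Cc.
  have [s [ns [r [d [Cd Es]]]]] := HN1 _ len _ (@adjoin_sub _ _ a _ Cc).
  exists s, d, r; split=> //.
  have ->: r * a = s * c - d by rewrite Es addrK.
  by apply: idealB => //; [exact: idealM | exact: dC].
(* Either a is in every C n at P, or r a in C n forces r in P for large n. *)
have [units|] := pselect (forall n, exists u, ~ P u /\ C n (u * a)).
  exists N1 => n len c Cc; have [s [d [r [ns Cd _ Es]]]] := step _ _ len Cc.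
  have [u [nu Cu]] := units n.+1.
  exists (u * s); split; first exact: primeMn.
  have ->: u * s * c = r * (u * a) + u * d by rewrite -mulrA Es; ring.
  by apply: idealL => //; exact: idealM.
move=> /existsNP[N2 nu].
exists (maxn N1 N2) => n; rewrite geq_max => /andP[le1 le2] c Cc.
have [s [d [r [ns Cd Cr Es]]]] := step _ _ le1 Cc.
have /PT[t [nt Kt]] : P r.
  by apply: contrapT => nr; apply: nu; exists r; split=> //; exact: cle Cr.
exists (t * s); split; first exact: primeMn.
rewrite -mulrA Es mulrDr; apply: idealD => //; first exact: KC.
exact: idealM.
Qed.

(** * Krull's principal ideal and height theorems *)

(** Krull's principal ideal theorem in the domain R / Q': no prime Q lies
    strictly between Q' and a prime P minimal over Q' + (x).  For y in Q, let
    D n be the contraction of (y ^ n) + Q' from the ring where x is inverted.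
    The chain D n + (x) stabilizes at P, and x is a nonzerodivisor modulo D n,
    so D n = D n.+1 + x D n and by Nakayama's lemma D n = D n.+1.  Then
    y ^ n is, up to a multiplier outside Q, a multiple of y ^ n.+1; if y were
    not in Q' one could cancel y ^ n and get this multiplier in Q. *)
Lemma krull_principal_ideal Q' Q P x :
  is_prime Q' -> is_prime Q -> Q' `<=` Q -> Q `<=` P ->
  minimal_over P (adjoin Q' x) -> ~ P `<=` Q -> Q `<=` Q'.
Proof.
move=> pQ' pQ Q'Q QP minP nPQ y Qy.
have [iQ' iQ] := (prime_ideal pQ', prime_ideal pQ).
have [pP JP mP] := minP; have iP := prime_ideal pP.
have nQx : ~ Q x by move=> Qx; apply: nPQ; apply: mP => //; exact: adjoin_min.
have Px : P x by apply: JP; exact: adjoin_mem.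
pose D n : set R := [set z | exists k, adjoin Q' (y ^+ n) (x ^+ k * z)].
have iA n : is_ideal (adjoin Q' (y ^+ n)) by exact: adjoin_ideal.
have iD n : is_ideal (D n).
  apply/is_idealP; split; first by exists 0%N; rewrite mulr0; exact: ideal0.
  move=> a u v [k Hu] [m Hv]; exists (k + m)%N.
  have ->: x ^+ (k + m) * (a * u + v) =
    (x ^+ m * a) * (x ^+ k * u) + x ^+ k * (x ^+ m * v) by rewrite exprD; ring.
  by apply: idealL => //; exact: idealM.
have dD n : D n.+1 `<=` D n.
  move=> z [k [r [w [Qw E]]]]; exists k, (r * y), w; split=> //.
  by rewrite E exprS mulrA.
have [|||| N HN] := @local_dcc P (adjoin Q' x) _ minP (fun n => adjoin (D n) x).
- exact: adjoin_ideal.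
- by move=> n; exact: adjoin_ideal.
- move=> n; apply: adjoinS => z Qz; exists 0%N; rewrite mul1r.
  exact: adjoin_sub.
- by move=> n; exact: adjoinS.
have [l El] := noetherian_fg (iD N).
have DN : D N `<=` sat P (D N.+1).
  rewrite {1}El; apply: (nakayama pP (iD N.+1) Px) => b lb.
  have Db : D N b by rewrite El; exact: ideal_span_mem.
  have [s [ns [r [d [Dd Es]]]]] := HN N (leqnn N) b (@adjoin_sub _ _ x _ Db).
  exists s, d, r; split=> //; last by rewrite Es; ring.
  rewrite -El.
  have [k Hk] : D N (s * b - d).
    by apply: idealB (dD _ _ Dd) => //; exact: idealM.
  exists k.+1; have -> // : x ^+ k.+1 * r = x ^+ k * (s * b - d).
  by rewrite Es exprSr; ring.
have [|s [ns [k [r [w [Qw E]]]]]] := DN (y ^+ N).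
  by exists 0%N; rewrite mul1r; exact: adjoin_mem.
apply: contrapT => nQ'y.
have /Q'Q Qe : Q' (x ^+ k * s - r * y).
  apply: (@primeM _ _ (y ^+ N)) => //; last by move/(primeX pQ').
  have -> // : y ^+ N * (x ^+ k * s - r * y) = w.
  have ->: y ^+ N * (x ^+ k * s - r * y) =
     x ^+ k * (s * y ^+ N) - r * (y ^+ N * y) by ring.
  by rewrite E exprSr; ring.
have Qxs : Q (x ^+ k * s).
  by rewrite -[_ * s](subrK (r * y)); apply: idealD => //; exact: idealM.
apply: ns; apply/QP/(primeM pQ Qxs) => /(primeX pQ); exact: nQx.
Qed.

(** Induction on the number of generators.  Given a chain ending at P, take a
    prime Q strictly below P, above the rest of the chain and maximal such, and
    a generator x outside Q.  P is minimal over Q + (x), so some power of every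
    other generator y is, up to a unit at P, of the form r x + q y with q y in
    Q.  As P is minimal over (x) + (the q y), the principal ideal theorem makes
    Q minimal over the ideal of the q y, which has one generator less. *)
Lemma krull_height l P m :
  minimal_over P (ideal_span l) -> prime_chain P m -> (m <= size l)%N.
Proof.
elim: {l}(size l) {-2}l (erefl (size l)) P m => [|n IH] l sl P m minP.
  case: m => // m [c [cp cs cP]]; have [pP _ mP] := minP.
  have [_] := cs m (ltnSn m); case; rewrite cP; apply: mP; first exact: cp.
    move: sl => /size0nil -> _ /= ->.
    exact: ideal0 (prime_ideal (cp _ (leqnSn m))).
  by rewrite -cP; case: (cs m (ltnSn m)).
case: m => // m [c [cp cs cP]]; have [pP lP mP] := minP.
have iP := prime_ideal pP.
have [Q [[pQ cQ QP nPQ] mxQ]] : exists Q,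
    [/\ is_prime Q, c m `<=` Q, Q `<=` P & ~ P `<=` Q] /\
    forall K, [/\ is_prime K, c m `<=` K, K `<=` P & ~ P `<=` K] ->
      Q `<=` K -> K `<=` Q.
  apply: noetherian_max => [K [+ _ _ _]|]; first exact: prime_ideal.
  exists (c m); have := cs m (ltnSn m); rewrite cP => -[cmP ?].
  by split=> //; exact: cp.
have iQ := prime_ideal pQ.
have [x [lx nQx]] : exists x, x \in l /\ ~ Q x.
  apply: contrapT => nx; apply: nPQ; apply: mP => //.
  apply: ideal_span_min => //.
  by move=> x lx; apply: contrapT => nQx; apply: nx; exists x.
have Px : P x by apply: lP; exact: ideal_span_mem.
have minPQ : minimal_over P (adjoin Q x).
  split=> //; first exact: adjoin_min.
  move=> T pT QT TP; apply: contrapT => nPT; apply: nQx.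
  apply: (mxQ T); last by apply: QT; exact: adjoin_mem.
    split=> //; apply: (subset_trans cQ).
    by apply: subset_trans QT; exact: adjoin_sub.
  by apply: subset_trans QT; exact: adjoin_sub.
have red y : exists q, y \in l ->
    [/\ Q q & exists N r u, ~ P u /\ u * y ^+ N = r * x + q].
  have [ly|] := pselect (y \in l); last by exists 0.
  have Py : P y by apply: lP; exact: ideal_span_mem.
  have [N [u [nu [r [q [Qq E]]]]]] :=
    minimal_over_nilp (adjoin_ideal x iQ) minPQ Py.
  by exists q => _; split=> //; exists N, r, u.
have [q qP] := choice red.
pose l' := [seq q y | y <- rem x l].
have sl' : size l' = n by rewrite size_map size_rem // sl.
have lQ : ideal_span l' `<=` Q.
  apply: ideal_span_min => // _ /mapP[y ly ->].
  by have [] := qP y (mem_rem ly).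
have minQ : minimal_over Q (ideal_span l').
  split=> // T pT lT TQ; have iT := prime_ideal pT.
  apply: (@krull_principal_ideal T Q P x) => //.
  split=> //; first by apply: adjoin_min => //; apply: subset_trans QP.
  move=> S pS TS SP; have iS := prime_ideal pS.
  have Sx : S x by apply: TS; exact: adjoin_mem.
  apply: mP => //; apply: ideal_span_min => // y ly.
  have [->//|nyx] := eqVneq y x.
  have lry : y \in rem x l.
    have := perm_to_rem lx => /perm_mem /(_ y); rewrite ly inE (negPf nyx) /=.
    by move=> <-.
  have [_ [N [r [u [nu E]]]]] := qP y ly.
  apply: (@primeX _ _ _ N) => //; apply: (@primeM _ _ u) => //; last by move/SP.
  rewrite E; apply: idealL => //.
  by apply: TS; apply/adjoin_sub/lT/ideal_span_mem/map_f.
rewrite sl ltnS -sl'; apply: (IH _ _ Q) => //.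
exists (fun i => if (i < m)%N then c i else Q); split.
- by move=> i _; case: ifP => // im; apply: cp; rewrite ltnW // ltnS ltnW.
- move=> i im; rewrite im; have [cc ncc] := cs i (ltnW im).
  case: ltnP => [//|mi]; have Ei : i.+1 = m by apply/eqP; rewrite eqn_leq im.
  rewrite Ei in cc ncc; split; first exact: subset_trans cQ.
  by move=> Qc; apply: ncc; exact: subset_trans Qc.
- by rewrite ltnn.
Qed.

End Noetherian.

(** * Height *)

Section Height.
Variable R : comPzRingType.

Lemma prime_height_ge0 (P : set R) : is_prime P -> (0 <= prime_height P)%E.
Proof.
move=> pP; rewrite /prime_height /supremum; case: ifPn => // _.
case: xgetP => // y _ [uy _]; apply: uy; exists 0%N => //.
by exists (fun=> P); split.
Qed.

Lemma prime_height_le (P : set R) n :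
  is_prime P -> (forall m, prime_chain P m -> (m <= n)%N) ->
  (prime_height P <= n%:Z%:E)%E.
Proof.
move=> pP len; rewrite /prime_height /supremum; case: ifPn => // _.
case: xgetP => [y _ [_ ly]|_]; last by rewrite lee_fin.
by apply: ly => _ [m /len lemn <-]; rewrite lee_fin lez_nat.
Qed.

(** [infimum] is a lower bound as soon as an infimum exists.  For the set of
    heights of the primes above an ideal it does exist, as a minimum, once one
    of these heights is finite. *)
Lemma natural_minimum (S : set (\bar int)) n :
  (forall x, S x -> (0 <= x)%E) -> S n%:Z%:E -> exists x, S x /\ lbound S x.
Proof.
move=> S0; elim/ltn_ind: n => n IH Sn.
have [lb|] := pselect (lbound S n%:Z%:E); first by exists n%:Z%:E.
move=> /existsNP[x /not_implyP[Sx /negP]]; rewrite -ltNge => ltxn.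
have x0 := S0 _ Sx; move: x0 Sx ltxn; case: x => [[k|k]||] // _ Sk.
by rewrite lte_fin ltz_nat => /IH; apply.
Qed.

Lemma height_le (I : ideal R) (P : set R) n :
  is_prime P -> (I : set R) `<=` P ->
  (forall m, prime_chain P m -> (m <= n)%N) -> (height I <= n%:Z%:E)%E.
Proof.
move=> pP IP len.
pose S := [set prime_height P |
  P in [set P | is_prime P /\ (I : set R) `<=` P]].
have S0 x : S x -> (0 <= x)%E by move=> [Q [pQ _] <-]; exact: prime_height_ge0.
have SP : S (prime_height P) by exists P.
have hPn := prime_height_le pP len.
have [k hPk] : exists k : nat, prime_height P = k%:Z%:E.
  by move: (S0 _ SP) hPn; case: (prime_height P) => [[k|k]||] // _ _; exists k.
rewrite hPk in SP.
have [x [Sx lx]] := natural_minimum S0 SP.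
apply: le_trans hPn; rewrite hPk; apply: le_infimum_Nmem => //.
by exists x; split=> // y ly; apply: ly.
Qed.

End Height.

(** * Ideals of minors *)

Section Minors.
Variable R : comPzRingType.

(** Expansion by multilinearity in the rows of the product; grouping the terms
    by the image of f would give the Cauchy-Binet formula. *)
Lemma det_mulmx_rect t s (U : 'M[R]_(t, s)) (B : 'M[R]_(s, t)) :
  \det (U *m B) =
  \sum_(f : {ffun 'I_t -> 'I_s}) \det (rowsub f B) * \prod_i U i (f i).
Proof.
pose UB (s : 'S_t) i j := U i j * B j (s i).
transitivity (\sum_(f : {ffun 'I_t -> 'I_s})
    \sum_(s : 'S_t) (-1) ^+ s * \prod_i UB s i (f i)).
  rewrite exchange_big; apply: eq_bigr => /= p _; rewrite -big_distrr /=.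
  congr (_ * _); rewrite -(bigA_distr_bigA (UB p)) /=.
  by apply: eq_bigr => x _; rewrite mxE.
apply: eq_bigr => f _; rewrite mulrC big_distrr /=; apply: eq_bigr => p _.
rewrite mulrCA big_split //=; congr (_ * (_ * _)).
by apply: eq_bigr => x _; rewrite mxE.
Qed.

(** The order in which the rows of a minor are taken only changes its sign;
    this provides the increasing order required by [minors]. *)
Lemma injective_sort t s (f : 'I_t -> 'I_s) : injective f ->
  exists (p : 'S_t) (h : 'I_t -> 'I_s),
    {homo h : i j / (i < j)%N} /\ f =1 h \o p.
Proof.
case: t f => [|t] f injf; first by exists 1%g, f; split=> -[].
pose A := [set f i | i in 'I_t.+1]%SET.
have cA : #|A| = t.+1 by rewrite card_imset // card_ord.
pose h (i : 'I_t.+1) := enum_val (cast_ord (esym cA) i).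
have fA i : f i \in A by exact: imset_f.
pose q i := cast_ord cA (enum_rank_in (fA ord0) (f i)).
have hq i : h (q i) = f i by rewrite /h cast_ordK enum_rankK_in.
have injq : injective q by move=> i j /(congr1 h); rewrite !hq => /injf.
exists (perm injq), h; split; last by move=> i /=; rewrite permE hq.
move=> i j ltij; rewrite /h !(enum_val_nth (f ord0)) /=.
have srt : sorted (fun x y : 'I_s => (x < y)%N) (enum A).
  rewrite -(@sorted_map _ _ (@nat_of_ord s) ltn) /enum_mem.
  apply: (@subseq_sorted _ ltn ltn_trans _ (iota 0 s)).
    rewrite -val_enum_ord map_subseq // enumT; exact: filter_subseq.
  exact: iota_ltn_sorted.
have szA : size (enum A) = t.+1 by rewrite -cardE.
apply: (sorted_ltn_nth _ (f ord0) srt) => //; rewrite ?inE ?szA //.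
by move=> x y z; exact: ltn_trans.
Qed.

(** The rows of U A are combinations of those of A, so its minors are
    combinations of minors of A: repeated rows contribute 0. *)
Lemma minor_mulmx m r (A : 'M[R]_(m, r)) t (U : 'M[R]_(t, m))
    (g : 'I_t -> 'I_r) :
  {homo g : i j / (i < j)%N} ->
  (minors_ideal A t : set R) (\det (colsub g (U *m A))).
Proof.
move=> hg; have iM := ideal_setP (minors_ideal A t).
rewrite -mulmx_colsub det_mulmx_rect; elim/big_ind: _ => [|x y|f _].
- exact: ideal0.
- exact: idealD.
rewrite mulrC; apply: (idealM _ iM).
have [/injectiveP injf|/injectivePn[i [j nij fij]]] := boolP (injectiveb f).
  have [p [h [hh fE]]] := injective_sort injf.
  have ->: rowsub f (colsub g A) = row_perm p (mxsub h g A).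
    by apply/matrixP => i j; rewrite !mxE fE.
  rewrite row_permE det_mulmx; apply: (idealM _ iM).
  by apply: ideal_gen_sub; exists h, g.
rewrite (determinant_alternate nij); first exact: ideal0.
by move=> k; rewrite !mxE fij.
Qed.

Section Relations.
Variables (m r : nat) (A : 'M[R]_(m, r)) (a : 'I_r -> R).

(** The relations a_i e_k - a_k e_i, for t indices k other than i, have the
    scalar matrix a_i on the columns k. *)
Lemma koszul_minor t i :
  (forall v : 'rV_r, \sum_l v 0 l * a l = 0 -> exists w, v = w *m A) ->
  (t < r)%N -> (minors_ideal A t : set R) (a i ^+ t).
Proof.
move=> relA ltr; have ler : (t <= r.-1)%N by case: r ltr.
(* The columns of the minor: the first t indices other than i. *)
pose g (k : 'I_t) : 'I_r := lift i (widen_ord ler k).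
have hg : {homo g : k l / (k < l)%N}.
  by move=> k l; rewrite !ltnNge leq_bump2.
pose v k : 'rV_r := a i *: delta_mx 0 (g k) - a (g k) *: delta_mx 0 i.
have sum_delta (c : R) k :
    \sum_l (c *: delta_mx 0 k : 'rV_r) 0 l * a l = c * a k.
  rewrite (bigD1 k) //= !mxE !eqxx mulr1 big1 ?addr0 // => l nlk.
  by rewrite !mxE (negPf nlk) mulr0 mul0r.
have /choice[w wP] k : exists w, v k = w *m A.
  apply: relA; under eq_bigr do rewrite mxE [X in _ + X]mxE mulrDl mulNr.
  by rewrite big_split sumrN /= !sum_delta; ring.
have -> : a i ^+ t = \det (colsub g ((\matrix_k w k) *m A));
  last exact: minor_mulmx.
rewrite -det_scalar; congr (\det _); apply/matrixP => k l.
have -> : colsub g ((\matrix_k w k) *m A) k l = v k 0 (g l).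
  by rewrite mxE wP !mxE; apply: eq_bigr => n _; rewrite mxE.
have injg : injective g by move=> x y /lift_inj /(congr1 val) /= /val_inj.
rewrite !mxE eqxx /= (inj_eq injg) [_ == i]eq_sym (negPf (neq_lift _ _)).
by rewrite mulr0 subr0 eq_sym mulr_natr.
Qed.

(** Cramer's rule: the relations of rows f express B b through the generators
    outside the columns g, where B is the minor's matrix and b the column of the
    generators a (g i); multiplying by the adjugate of B isolates det B * a_k. *)
Lemma minor_mul_generator t (f : 'I_t -> 'I_m) (g : 'I_t -> 'I_r)
    (T : set R) k :
  (forall i, \sum_l A i l * a l = 0) -> injective g -> is_ideal T ->
  (forall l, l \notin codom g -> T (a l)) ->
  T (\det (mxsub f g A) * a k).
Proof.
move=> relA injg iT aT.
have [/codomP[k' ->]|nk] := boolP (k \in codom g); last first.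
  by apply: (idealM _ iT); exact: aT.
pose B := mxsub f g A; pose b : 'cV_t := \col_i a (g i).
have TB i : T ((B *m b) i 0).
  rewrite mxE.
  have -> : \sum_j B i j * b j 0 =
      - \sum_(l | l \notin codom g) A (f i) l * a l.
    apply/eqP; rewrite -addr_eq0; apply/eqP; rewrite -[RHS](relA (f i)).
    rewrite [RHS](bigID (mem (codom g))) /=; congr (_ + _).
    rewrite (reindex_omap g (fun l => [pick j | g j == l])) /=; last first.
      move=> _ /codomP[j ->]; case: pickP => [j' /eqP gj|/(_ j)] /=.
        by rewrite gj.
      by rewrite eqxx.
    apply: eq_big => [j|j _]; last by rewrite !mxE.
    rewrite codom_f /=.
    case: pickP => [j' /eqP gj|/(_ j)]; last by rewrite eqxx.
    by rewrite (injg _ _ gj) eqxx.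
  rewrite -mulN1r; apply: idealM => //; elim/big_ind: _ => [|x y|l nl].
  - exact: ideal0.
  - exact: idealD.
  - by apply: (idealM _ iT); exact: aT.
have -> : \det B * a (g k') = (\adj B *m (B *m b)) k' 0.
  by rewrite mulmxA mul_adj_mx mul_scalar_mx !mxE.
by rewrite mxE; apply: ideal_sum => // j; exact: idealM.
Qed.

End Relations.
End Minors.

(** * Presentations of ideals *)

Section Presentations.
Variable R : comPzRingType.

Lemma presentation_generators (I : ideal R) (p : presentation (ideal_mod I)) :
  exists a : 'I_(pres_rank p) -> R,
    [/\ forall l, (I : set R) (a l),
        forall x, (I : set R) x ->
          exists v : 'rV_(pres_rank p), x = \sum_l v 0 l * a l &
        forall v : 'rV_(pres_rank p),
          \sum_l v 0 l * a l = 0 <-> exists w, v = w *m pres_mx p].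
Proof.
pose a l : R := val (pres_map p (delta_mx 0 l)).
have mapE v : val (pres_map p v) = \sum_l v 0 l * a l.
  rewrite {1}(row_sum_delta v) !linear_sum /=; apply: eq_bigr => l _.
  by rewrite !linearZ.
exists a; split=> [l|x Ix|v].
- exact/set_mem/(valP (pres_map p (delta_mx 0 l))).
- have [v pv] := pres_surj p (Sub x (mem_set Ix)).
  by exists v; rewrite -mapE pv.
- rewrite -mapE; split=> [v0|/(@pres_exact _ _ p) -> //].
  by apply/(@pres_exact _ _ p)/val_inj.
Qed.

Hypothesis noethR : noetherian R.

(** Submodules of R ^ r are finitely generated, as row spaces: the first
    coordinates of the elements of N form an ideal, and lifts V of generators of
    it reduce the question to the elements of N with first coordinate 0. *)
Lemma noetherian_submodule r (N : set 'rV[R]_r) :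
  N 0 -> (forall c u v, N u -> N v -> N (c *: u + v)) ->
  exists m (A : 'M[R]_(m, r)), forall v, N v <-> exists w, v = w *m A.
Proof.
elim: r N => [|r IH] N N0 NL.
  exists 0%N, 0 => v; split=> _; first by exists 0; rewrite (thinmx0 v) mulmx0.
  by rewrite (thinmx0 v).
have ND u v : N u -> N v -> N (u + v).
  by move=> Nu; rewrite -[u]scale1r; exact: NL.
pose L : set R := [set x | exists2 v, N v & v 0 0 = x].
have iL : is_ideal L.
  apply/is_idealP; split; first by exists 0; rewrite ?mxE.
  move=> c _ _ [u Nu <-] [v Nv <-].
  by exists (c *: u + v); [exact: NL | rewrite !mxE].
have row0E (d : 'rV[R]_(1 + r)) : d 0 0 = 0 -> d = row_mx 0 (rsubmx d).
  move=> d0; rewrite -{1}[d]hsubmxK; congr row_mx; apply/rowP => i.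
  by rewrite (ord1 i) !mxE -[RHS]d0; congr (d _ _); exact/val_inj.
have [l El] := noetherian_fg noethR iL.
have lL x : x \in l -> L x by rewrite El; exact: ideal_span_mem.
have [m [V [NV LV]]] : exists m (V : 'M[R]_(m, r.+1)),
    (forall w : 'rV_m, N (w *m V)) /\
    (forall x, ideal_span l x -> exists w : 'rV_m, (w *m V) 0 0 = x).
  elim: l lL {El} => [|x l IHl] lL.
    by exists 0%N, 0; split=> [w|_ ->]; [|exists 0]; rewrite mulmx0 ?mxE.
  have [|m [V [NV LV]]] := IHl.
    by move=> y ly; apply: lL; rewrite inE ly orbT.
  have [u Nu ux] : L x by apply: lL; exact: mem_head.
  exists (1 + m)%N, (col_mx u V); split=> [w|_ [c [_ [/LV[w <-] ->]]]].
    rewrite -[w]hsubmxK mul_row_col [lsubmx w]mx11_scalar mul_scalar_mx.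
    exact: NL.
  exists (row_mx c%:M w); rewrite mul_row_col mul_scalar_mx [LHS]mxE mxE ux.
  by [].
have [||m' [A' HA']] := IH [set u | N (row_mx (0 : 'rV_1) u)].
- by rewrite /= row_mx0.
- move=> c u v /= Nu Nv.
  have ->: row_mx 0 (c *: u + v) = c *: row_mx 0 u + row_mx 0 v :> 'rV_(1 + r).
    by rewrite scale_row_mx add_row_mx scaler0 addr0.
  exact: NL.
pose B : 'M[R]_(m', r.+1) := row_mx (0 : 'M_(m', 1)) A'.
have mulB (u : 'rV_m') : u *m B = row_mx (0 : 'rV_1) (u *m A').
  by rewrite -[0 in RHS](mulmx0 _ u) -mul_mx_row.
exists (m + m')%N, (col_mx V B) => v; split.
  move=> Nv; have [|w wV] := LV (v 0 0); first by rewrite -El; exists v.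
  have Nd : N (v - w *m V).
    by rewrite addrC -scaleN1r; exact: NL.
  have Ed : v - w *m V = row_mx (0 : 'rV_1) (rsubmx (v - w *m V : 'rV_(1 + r))).
    by apply: row0E; rewrite mxE [X in _ + X]mxE wV subrr.
  have [w' Ew'] : exists w', rsubmx (v - w *m V : 'rV_(1 + r)) = w' *m A'.
    by apply/HA'; rewrite /= -Ed.
  exists (row_mx w w'); rewrite mul_row_col mulB -Ew' -Ed.
  by rewrite addrC subrK.
move=> [w ->]; rewrite -[w]hsubmxK mul_row_col; apply: ND => //.
rewrite mulB.
by apply/(HA' (rsubmx w *m A')); exists (rsubmx w).
Qed.

Lemma presentation_exists (I : ideal R) :
  exists _ : presentation (ideal_mod I), True.
Proof.
have [l El] := noetherian_fg noethR (ideal_setP I).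
pose r := size l; pose a (i : 'I_r) := nth 0 l i.
have iI := ideal_setP I.
have Ia i : (I : set R) (a i) by rewrite El; apply/ideal_span_mem/mem_nth.
pose comb (v : 'rV[R]_r) : R := \sum_i v 0 i * a i.
have Icomb v : comb v \in ideal_pred I.
  by apply: mem_set; apply: ideal_sum => // i; exact: idealM.
pose phi v : ideal_mod I := Sub (comb v : R^o) (Icomb v).
have phi_lin : linear phi.
  move=> c u v; apply: val_inj => /=.
  transitivity (c * comb u + comb v) => //.
  rewrite /comb mulr_sumr -big_split /=; apply: eq_bigr => i _.
  by rewrite !mxE; ring.
pose phiL : {linear 'rV[R]_r -> ideal_mod I} :=
  HB.pack phi (GRing.isLinear.Build _ _ _ _ phi phi_lin).
have [||m [A HA]] := @noetherian_submodule r [set v | phi v = 0].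
- exact: (linear0 phiL).
- by move=> c u v /= u0 v0; rewrite phi_lin u0 v0 scaler0 addr0.
have phi_surj x : exists v, phi v = x.
  have : ideal_span l (val x) by rewrite -El; exact/set_mem/(valP x).
  have spanE y : ideal_span l y -> exists v, comb v = y.
    rewrite /comb /a /r => {x phiL phi phi_lin Icomb comb Ia a r A HA m El}.
    elim: l y => [|x l IH] y /=; first by move=> ->; exists 0; rewrite big_ord0.
    move=> [c [_ [/IH[v <-] ->]]].
    exists (\row_i oapp (v 0) c (unlift ord0 i)).
    rewrite big_ord_recl mxE unlift_none; congr (_ * _ + _).
    by apply: eq_bigr => i _; rewrite mxE liftK.
  by move=> /spanE[v Ev]; exists v; apply: val_inj.
by exists (@Presentation _ _ r m A phiL phi_surj HA).
Qed.

End Presentations.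

(** * Radicals of Fitting ideals *)

Section Radicals.
Variable R : comPzRingType.

Lemma radicalP (I : ideal R) x :
  (radical I : set R) x <-> exists n, (I : set R) (x ^+ n).
Proof. by split=> -[n In]; exists n; [exact: set_mem In | exact: mem_set]. Qed.

Lemma ideal_eq (I J : ideal R) : (I : set R) = J -> I = J.
Proof.
case: I J => I iI [J iJ] /= E; subst J; congr Ideal.
exact: Prop_irrelevance.
Qed.

Lemma radical_sub (I J : ideal R) :
  (I : set R) `<=` radical J -> (radical I : set R) `<=` radical J.
Proof.
move=> IJ x /radicalP[n /IJ/radicalP[m]]; rewrite -exprM => Jx.
by apply/radicalP; exists (n * m)%N.
Qed.

Lemma sub_radical (I : ideal R) : (I : set R) `<=` radical I.
Proof. by move=> x Ix; apply/radicalP; exists 1%N. Qed.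

Lemma radical_idem (I : ideal R) : radical (radical I) = radical I.
Proof.
apply: ideal_eq; apply/seteqP; split; first exact: radical_sub.
exact: sub_radical.
Qed.

Lemma height_radical (I : ideal R) : height (radical I) = height I.
Proof.
rewrite /height; congr (infimum _ [set prime_height P | P in _]).
apply/seteqP; split=> P [pP IP]; split=> //.
  exact: subset_trans (@sub_radical I) IP.
by move=> x /radicalP[n /IP/(primeX pP)].
Qed.

End Radicals.

Section FittingIdeals.
Variable R : comPzRingType.
Hypothesis noethR : noetherian R.

(** The presentation that [Fitt] uses is arbitrary; only properties shared by
    all presentations are used below. *)
Lemma FittE (I : ideal R) j : exists p : presentation (ideal_mod I),
  Fitt j (ideal_mod I) = minors_ideal (pres_mx p) (pres_rank p - j).
Proof.
rewrite /Fitt; case: pselect => [ex|]; last by case; exact: presentation_exists.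
by exists (projT1 (cid ex)).
Qed.

Lemma ideal_sub_radical_Fitt (I : ideal R) j : (0 < j)%N ->
  (I : set R) `<=` radical (Fitt j (ideal_mod I)).
Proof.
move=> j0; have [p ->] := FittE I j.
have [a [_ Ia rel]] := presentation_generators p.
set F := radical _; have iF := ideal_setP F.
move=> x /Ia[v ->]; apply: ideal_sum => // l; apply: idealM => //.
apply/radicalP; exists (pres_rank p - j)%N; apply: koszul_minor.
  by move=> u /rel.
by rewrite ltn_subrL j0 (leq_ltn_trans _ (ltn_ord l)).
Qed.

Lemma Fitt_sub_radical_ideal (I : ideal R) j : (j%:Z%:E < height I)%E ->
  (Fitt j (ideal_mod I) : set R) `<=` radical I.
Proof.
move=> ltj; have [p ->] := FittE I j.
have [a [aI Ia rel]] := presentation_generators p.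
apply: ideal_gen_min => [|_ [f [g [_ hg ->]]]]; first exact: ideal_setP.
set D := \det _; apply: contrapT => nD.
have [||P [minP nPD]] := @minimal_over_avoid _ noethR I D.
- exact: ideal_setP.
- by move=> n In; apply: nD; apply/radicalP; exists n.
have injg : injective g.
  move=> x y Exy; apply: val_inj; apply/eqP; rewrite eqn_leq.
  by case: ltngtP => // /hg; rewrite Exy ltnn.
have [pP IP _] := minP.
pose l := [seq a i | i <- enum [predC codom g]].
have sl : (size l <= j)%N.
  rewrite size_map -cardE -(leq_add2l #|codom g|) cardC card_ord.
  by rewrite card_codom // card_ord addnC -leq_subLR.
have lI : ideal_span l `<=` (I : set R).
  apply: ideal_span_min => [|_ /mapP[i _ ->]]; last exact: aI.
  exact: ideal_setP.
have minPl : minimal_over P (ideal_span l).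
  split=> // [|T pT lT TP]; first exact: subset_trans IP.
  case: minP => _ _; apply=> // x /Ia[v ->]; have iT := prime_ideal pT.
  apply: ideal_sum => // k; apply: idealM => //.
  apply: (@primeM _ _ D) => //; last by move/TP.
  apply: (@minor_mul_generator _ _ _ (pres_mx p) a _ f g T k) => //.
    move=> i; have := (rel (row i (pres_mx p))).2.
    under eq_bigr do rewrite mxE; apply.
    by exists (delta_mx 0 i); rewrite -rowE.
  move=> k' nk'; apply/lT/ideal_span_mem/map_f.
  by rewrite mem_enum.
have := height_le pP IP
  (fun m ch => leq_trans (krull_height noethR minPl ch) sl).
by rewrite leNgt ltj.
Qed.

Lemma radical_Fitt (I : ideal R) j : (0 < j)%N -> (j%:Z%:E < height I)%E ->
  radical (Fitt j (ideal_mod I)) = radical I.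
Proof.
move=> j0 ltj; apply: ideal_eq; apply/seteqP; split; apply: radical_sub.
  exact: Fitt_sub_radical_ideal.
exact: ideal_sub_radical_Fitt.
Qed.

End FittingIdeals.

Theorem corollary4p2 (R : comPzRingType) (noethR : noetherian R)
    (I : ideal R) (h : \bar int) (htI : height I = h)
    (j : nat) (j_ge1 : (1 <= j)%N) (j_leh : ((j%:Z)%:E <= h - 1)%E) :
  radical (Fitt j (ideal_mod I)) = radical (Fitt j (ideal_mod (radical I))).
Proof.
have ltj : (j%:Z%:E < height I)%E.
  rewrite htI; move: j_leh; case: h {htI} => [h||] //.
  by rewrite -EFinB lee_fin lte_fin lerBrDr lezD1.
by rewrite !radical_Fitt ?height_radical ?radical_idem.
Qed.
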